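(* Any conformal soliton of the inverse curve shortening flow in $\mathbb{H}^2$ is a graph on the $x$-axis, i.e. it can be written in the form $y=y(x)$.
   Context: $\mathbb{H}^2$ is the upper half-plane $\{(x,y)\in\mathbb{R}^2: y>0\}$ with metric $(dx^2+dy^2)/y^2$. For a regular curve $\gamma\colon I\to\mathbb{H}^2$, $\gamma=(x,y)$, $I$ an interval, the unit normal is $N=y\,(-y',x')/\sqrt{x'^2+y'^2}$ and the hyperbolic curvature is $\kappa=y\kappa_e+x'/\sqrt{x'^2+y'^2}$, where $\kappa_e=(x'y''-x''y')/(x'^2+y'^2)^{3/2}$. A conformal soliton of the inverse curve shortening flow is a curve satisfying $1/\kappa=-\langle N,\partial_y\rangle$ (in particular $\kappa\neq0$). When $\gamma$ is parametrized by Euclidean arc length with $x'=\cos\theta$, $y'=\sin\theta$, this is equivalent to $\theta'=-\frac{1}{\cos\theta}-\frac{\cos\theta}{y}$. *)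

(* Defs.v *)
From Stdlib Require Import Reals.
Open Scope R_scope.

(** Any interval of [R] (open or closed, bounded or not) with more than one
    point. *)
Definition interval (I : R -> Prop) : Prop :=
  (forall a b c, I a -> I c -> a <= b <= c -> I b) /\
  (exists a b, I a /\ I b /\ a < b).

(** [D_in] and [continue_in] are relative to [I], so derivatives are one-sided
    at the endpoints that belong to [I].  On a nondegenerate interval [f'] and
    [f''] are determined by [f] at the points of [I]. *)
Definition C2_on (I : R -> Prop) (f f' f'' : R -> R) : Prop :=
  forall t, I t -> D_in f f' I t /\ D_in f' f'' I t /\ continue_in f'' I t.

Definition upper_half_plane (p : R * R) : Prop := 0 < snd p.

(** The metric [(dx^2 + dy^2) / y^2] at the point [p]. *)
Definition hyp_inner (p u v : R * R) : R :=
  (fst u * fst v + snd u * snd v) / (snd p) ^ 2.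

Definition partial_y : R * R := (0, 1).

Definition euclidean_norm (v : R * R) : R := sqrt (fst v ^ 2 + snd v ^ 2).

(** In the next three definitions [p], [v], [a] stand for the values of
    [gamma], [gamma'], [gamma''] at one parameter. *)
Definition unit_normal (p v : R * R) : R * R :=
  (snd p * - snd v / euclidean_norm v, snd p * fst v / euclidean_norm v).

Definition euclidean_curvature (v a : R * R) : R :=
  (fst v * snd a - fst a * snd v) / Rpower (fst v ^ 2 + snd v ^ 2) (3 / 2).

Definition hyperbolic_curvature (p v a : R * R) : R :=
  snd p * euclidean_curvature v a + fst v / euclidean_norm v.

Definition regular_curve (I : R -> Prop) (gamma gamma' gamma'' : R -> R * R)
  : Prop :=
  C2_on I (fun t => fst (gamma t)) (fun t => fst (gamma' t))
    (fun t => fst (gamma'' t)) /\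
  C2_on I (fun t => snd (gamma t)) (fun t => snd (gamma' t))
    (fun t => snd (gamma'' t)) /\
  (forall t, I t -> upper_half_plane (gamma t)) /\
  (forall t, I t -> gamma' t <> (0, 0)).

(** The condition [kappa <> 0] is needed because [/ 0] is a total expression. *)
Definition conformal_soliton (I : R -> Prop) (gamma : R -> R * R) : Prop :=
  exists gamma' gamma'' : R -> R * R,
    regular_curve I gamma gamma' gamma'' /\
    forall t, I t ->
      let kappa := hyperbolic_curvature (gamma t) (gamma' t) (gamma'' t) in
      let N := unit_normal (gamma t) (gamma' t) in
      kappa <> 0 /\ 1 / kappa = - hyp_inner (gamma t) N partial_y.

(** The trace of [gamma] is the graph of a C^2 function [f] on an interval [J]
    of the x-axis.  For a regular curve this also forces [x'] not to vanish
    (since [y' = f'(x) x']), so [gamma] runs through the graph exactly once. *)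
Definition graph_on_x_axis (I : R -> Prop) (gamma : R -> R * R) : Prop :=
  exists (J : R -> Prop) (f f' f'' : R -> R),
    interval J /\ C2_on J f f' f'' /\
    forall p : R * R,
      (exists t, I t /\ gamma t = p) <-> (J (fst p) /\ snd p = f (fst p)).

(* Main.v *)
Require Import Defs.
From Stdlib Require Import Reals Lra Classical ClassicalEpsilon.
From Coquelicot Require Import Coquelicot.
Open Scope R_scope.

(** The equation gives [1 / kappa = - x' / (y |gamma'|)], and [1 / kappa <> 0],
    so [x'] never vanishes.  Hence [x] is strictly monotone, and the curve is
    the graph of [y o x^-1], whose first two derivatives are obtained from
    [d/dx = (1 / x') d/dt]. *)

(** * Intermediate and mean value theorems relative to an interval *)

(** Composing with this retraction of the line onto [[a, b]] extends a function given on [[a, b]] to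
    all of R, so that [IVT_gen] and [MVT_gen] apply. *)
Definition clamp (a b t : R) : R := Rmax a (Rmin b t).

Lemma clamp_id (a b t : R) : a <= t <= b -> clamp a b t = t.
Proof.
  intros H; unfold clamp; rewrite Rmin_right by lra; rewrite Rmax_right; lra.
Qed.

Lemma clamp_bounds (a b t : R) : a <= b -> a <= clamp a b t <= b.
Proof.
  intros H; unfold clamp, Rmax, Rmin.
  destruct (Rle_dec b t); destruct (Rle_dec a _); lra.
Qed.

Lemma clamp_dist (a b t s : R) :
  Rabs (clamp a b t - clamp a b s) <= Rabs (t - s).
Proof.
  unfold clamp, Rmax, Rmin, Rabs.
  destruct (Rle_dec b t), (Rle_dec b s); repeat destruct (Rle_dec a _);
    repeat destruct (Rcase_abs _); lra.
Qed.

Lemma clamp_continuity (I : R -> Prop) (f : R -> R) (a b : R) :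
  (forall t, a <= t <= b -> I t) -> (forall t, I t -> continue_in f I t) ->
  a <= b -> continuity (fun t => f (clamp a b t)).
Proof.
  intros HI Hf Hab t eps Heps.
  pose proof (clamp_bounds a b t Hab) as Ht.
  destruct (Hf _ (HI _ Ht) eps Heps) as [d [Hd H]].
  exists d; split; [exact Hd|].
  intros s [_ Hs].
  (* [continue_in] only speaks of points other than the base point, and clamping can identify [s]
     with [t]. *)
  destruct (Req_dec (clamp a b s) (clamp a b t)) as [E|E].
  - rewrite E; simpl; unfold R_dist; rewrite Rminus_diag, Rabs_R0; lra.
  - apply H; split.
    + split; [apply HI, clamp_bounds, Hab | auto].
    + apply Rle_lt_trans with (2 := Hs), clamp_dist.
Qed.

Lemma IVT_on (I : R -> Prop) (f : R -> R) (a b c : R) :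
  (forall t, a <= t <= b -> I t) -> (forall t, I t -> continue_in f I t) ->
  a <= b -> Rmin (f a) (f b) <= c <= Rmax (f a) (f b) ->
  exists t, a <= t <= b /\ f t = c.
Proof.
  intros HI Hf Hab Hc.
  destruct (IVT_gen _ a b c (clamp_continuity I f a b HI Hf Hab)) as [t [_ E]].
  - rewrite !clamp_id by lra; exact Hc.
  - exists (clamp a b t); split; [apply clamp_bounds, Hab | exact E].
Qed.

Lemma MVT_on (I : R -> Prop) (f f' : R -> R) (a b : R) :
  (forall t, a <= t <= b -> I t) -> (forall t, I t -> D_in f f' I t) ->
  a < b -> exists c, a <= c <= b /\ f b - f a = f' c * (b - a).
Proof.
  intros HI Hf Hab.
  destruct (MVT_gen (fun t => f (clamp a b t)) a b f') as [c [Hc E]].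
  - rewrite Rmin_left, Rmax_right by lra; intros t Ht.
    apply is_derive_Reals; intros eps Heps.
    destruct (Hf t (HI t ltac:(lra)) eps Heps) as [d [Hd H]].
    (* This radius keeps [t + h] inside [[a, b]], where [clamp] is the identity. *)
    assert (Hm : 0 < Rmin d (Rmin (t - a) (b - t))).
    { repeat apply Rmin_pos; lra. }
    exists (mkposreal _ Hm); simpl; intros h Hh0 Hh.
    pose proof (Rmin_l d (Rmin (t - a) (b - t))).
    pose proof (Rmin_r d (Rmin (t - a) (b - t))).
    pose proof (Rmin_l (t - a) (b - t)).
    pose proof (Rmin_r (t - a) (b - t)).
    assert (Hh' : - h <= Rabs h /\ h <= Rabs h).
    { split; [rewrite <- Rabs_Ropp|]; apply Rle_abs. }
    rewrite !clamp_id by lra.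
    specialize (H (t + h)); simpl in H; unfold R_dist in H.
    replace (t + h - t) with h in H by ring.
    apply H; split; [split; [apply HI; lra | lra] | lra].
  - intros t _; apply (clamp_continuity I f a b HI); [|lra].
    intros s Hs; exact (cont_deriv _ _ _ _ (Hf s Hs)).
  - rewrite Rmin_left, Rmax_right in Hc by lra.
    rewrite !clamp_id in E by lra.
    exists c; split; assumption.
Qed.

(** * Strict monotonicity and continuity of the inverse *)

Definition strictly_increasing_on (I : R -> Prop) (f : R -> R) : Prop :=
  forall a b, I a -> I b -> a < b -> f a < f b.

(** By the intermediate value theorem [f'] keeps the sign it has at [a0], and the mean value theorem
    passes this sign to the increments of [f]. The decreasing case is put as an increasing [- f], so
    that the lemmas on increasing functions serve both cases. *)
Lemma monotone_of_derivative_neq_0 (I : R -> Prop) (f f' : R -> R) :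
  interval I -> (forall t, I t -> D_in f f' I t) ->
  (forall t, I t -> continue_in f' I t) -> (forall t, I t -> f' t <> 0) ->
  strictly_increasing_on I f \/ strictly_increasing_on I (fun t => - f t).
Proof.
  intros [HI [a0 [_ [Ha0 _]]]] Hf Hc Hn.
  assert (Hsub : forall a b, I a -> I b -> forall t, a <= t <= b -> I t).
  { intros a b Ha Hb t Ht; exact (HI a t b Ha Hb Ht). }
  assert (Hsign : forall a b, I a -> I b -> a <= b -> 0 < f' a * f' b).
  { intros a b Ha Hb Hab; apply Rnot_le_lt; intros Hle.
    destruct (IVT_on I f' a b 0 (Hsub a b Ha Hb) Hc Hab) as [t [Ht E]].
    - pose proof (Hn a Ha); pose proof (Hn b Hb).
      unfold Rmin, Rmax; destruct (Rle_dec (f' a) (f' b)); split; nra.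
    - exact (Hn t (Hsub a b Ha Hb t Ht) E). }
  assert (Hsign0 : forall a, I a -> 0 < f' a0 * f' a).
  { intros a Ha; destruct (Rle_dec a0 a).
    - apply Hsign; assumption.
    - rewrite Rmult_comm; apply Hsign; [assumption..|lra]. }
  destruct (Rdichotomy _ _ (Hn a0 Ha0)) as [H0|H0]; [right|left];
    intros a b Ha Hb Hab;
    destruct (MVT_on I f f' a b (Hsub a b Ha Hb) Hf Hab) as [c [Hc' E]];
    pose proof (Hsign0 c (Hsub a b Ha Hb c Hc')); nra.
Qed.

Lemma strictly_increasing_inj (I : R -> Prop) (f : R -> R) :
  strictly_increasing_on I f ->
  forall a b, I a -> I b -> f a = f b -> a = b.
Proof.
  intros H a b Ha Hb E; destruct (Rtotal_order a b) as [h|[h|h]]; [|exact h|].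
  - pose proof (H a b Ha Hb h); lra.
  - pose proof (H b a Hb Ha h); lra.
Qed.

(** Continuity of the inverse of [f] at [f t0], phrased through parameters so that no inverse
    function has to be named. *)
Definition inverse_continuous_on (I : R -> Prop) (f : R -> R) : Prop :=
  forall t0 eps, I t0 -> 0 < eps ->
  exists d, 0 < d /\
    forall t, I t -> Rabs (f t - f t0) < d -> Rabs (t - t0) < eps.

(** The two sides of [t0] are treated separately. If [t0 + eps] lies in [I], the gap
    [f (t0 + eps) - f t0] serves as [d] by monotonicity. Otherwise [I], being an interval, has no
    point beyond [t0 + eps], and any [d] will do. The left side is symmetric. *)
Lemma strictly_increasing_inv_cont (I : R -> Prop) (f : R -> R) :
  interval I -> strictly_increasing_on I f -> inverse_continuous_on I f.
Proof.
  intros [HI _] H t0 eps H0 Heps.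
  assert (Hr : exists d, 0 < d /\
    forall t, I t -> f t - f t0 < d -> t - t0 < eps).
  { destruct (classic (I (t0 + eps))) as [Hi|Hi].
    - exists (f (t0 + eps) - f t0); split.
      + pose proof (H t0 (t0 + eps) H0 Hi ltac:(lra)); lra.
      + intros t Ht Hd; apply Rnot_le_lt; intros Hle.
        destruct (Req_dec t (t0 + eps)) as [->|E]; [lra|].
        pose proof (H (t0 + eps) t Hi Ht ltac:(lra)); lra.
    - exists 1; split; [lra|]; intros t Ht _; apply Rnot_le_lt; intros Hle.
      apply Hi, (HI t0 _ t H0 Ht); lra. }
  assert (Hl : exists d, 0 < d /\
    forall t, I t -> f t0 - f t < d -> t0 - t < eps).
  { destruct (classic (I (t0 - eps))) as [Hi|Hi].
    - exists (f t0 - f (t0 - eps)); split.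
      + pose proof (H (t0 - eps) t0 Hi H0 ltac:(lra)); lra.
      + intros t Ht Hd; apply Rnot_le_lt; intros Hle.
        destruct (Req_dec t (t0 - eps)) as [->|E]; [lra|].
        pose proof (H t (t0 - eps) Ht Hi ltac:(lra)); lra.
    - exists 1; split; [lra|]; intros t Ht _; apply Rnot_le_lt; intros Hle.
      apply Hi, (HI t _ t0 Ht H0); lra. }
  destruct Hr as [d1 [Hd1 H1]]; destruct Hl as [d2 [Hd2 H2]].
  exists (Rmin d1 d2); split; [apply Rmin_pos; assumption|].
  intros t Ht Hd.
  pose proof (Rmin_l d1 d2); pose proof (Rmin_r d1 d2).
  apply Rabs_def2 in Hd; apply Rabs_def1.
  - apply H1; [assumption|lra].
  - pose proof (H2 t Ht ltac:(lra)); lra.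
Qed.

(** * Derivatives of reciprocals and of functions reparametrized by an inverse *)

Lemma D_in_inv (I : R -> Prop) (f f' : R -> R) (t : R) :
  (forall s, I s -> f s <> 0) -> I t -> D_in f f' I t ->
  D_in (fun s => / f s) (fun s => - f' s / f s ^ 2) I t.
Proof.
  intros Hn Ht Hf.
  pose proof (cont_deriv _ _ _ _ Hf : limit1_in f (D_x I t) (f t) t) as Hc.
  (* The difference quotient of [/ f] is minus that of [f], times [/ f s], times the constant
     [/ f t]; the [0] is a dummy argument of the constant function. *)
  pose proof (limit_mul _ _ _ _ _ _ (limit_mul _ _ _ _ _ _
    (limit_Ropp _ _ _ _ Hf) (limit_inv _ _ _ _ Hc (Hn t Ht)))
    (limit_free (fun _ => / f t) (D_x I t) 0 t)) as H.
  unfold D_in.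
  replace (- f' t / f t ^ 2) with (- f' t * / f t * / f t)
    by (field; exact (Hn t Ht)).
  refine (limit1_ext _ _ _ _ _ _ H).
  intros s [Hs Hst]; simpl; field.
  repeat split; auto; lra.
Qed.

Definition image (I : R -> Prop) (f : R -> R) (u : R) : Prop :=
  exists t, I t /\ f t = u.

Lemma interval_image (I : R -> Prop) (f : R -> R) :
  interval I -> (forall t, I t -> continue_in f I t) ->
  (forall a b, I a -> I b -> f a = f b -> a = b) -> interval (image I f).
Proof.
  intros [HI [a0 [b0 [Ha0 [Hb0 Hab0]]]]] Hc Hinj; split.
  - intros u v w [a [Ha <-]] [b [Hb <-]] Hv.
    assert (Hsub : forall p q, I p -> I q -> forall t, p <= t <= q -> I t).
    { intros p q Hp Hq t Ht; exact (HI p t q Hp Hq Ht). }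
    destruct (Rle_dec a b) as [Hab|Hab].
    + destruct (IVT_on I f a b v (Hsub a b Ha Hb) Hc Hab) as [t [Ht E]].
      * rewrite Rmin_left, Rmax_right by lra; exact Hv.
      * exists t; split; [exact (Hsub a b Ha Hb t Ht) | exact E].
    + destruct (IVT_on I f b a v (Hsub b a Hb Ha) Hc ltac:(lra))
        as [t [Ht E]].
      * rewrite Rmin_right, Rmax_left by lra; exact Hv.
      * exists t; split; [exact (Hsub b a Hb Ha t Ht) | exact E].
  - assert (Hne : f a0 <> f b0).
    { intros E; pose proof (Hinj a0 b0 Ha0 Hb0 E); lra. }
    destruct (Rdichotomy _ _ Hne).
    + exists (f a0), (f b0); split; [exists a0 | split; [exists b0|]]; auto.
    + exists (f b0), (f a0); split; [exists b0 | split; [exists a0|]]; auto.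
Qed.

(** Substitute [u = x t]: if [u] is close to [x t0] then [t] is close to [t0], and [u <> x t0]
    forces [t <> t0], so punctured limits carry over. *)
Lemma limit_comp_inverse (I : R -> Prop) (x g h : R -> R) (t0 l : R) :
  inverse_continuous_on I x -> (forall t, I t -> g (x t) = t) -> I t0 ->
  limit1_in h (D_x I t0) l t0 ->
  limit1_in (fun u => h (g u)) (D_x (image I x) (x t0)) l (x t0).
Proof.
  intros Hinv Hg H0 Hh eps Heps.
  destruct (Hh eps Heps) as [d [Hd H]].
  destruct (Hinv t0 d H0 Hd) as [e [He He']].
  exists e; split; [exact He|].
  intros u [[[t [Ht <-]] Hne] Hdist]; rewrite (Hg t Ht); apply H; split.
  - split; [exact Ht | congruence].
  - exact (He' t Ht Hdist).
Qed.

(** At [u = x t] the difference quotient of [y] after [g] is that of [y] divided by that of [x],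
    both taken between [t] and [t0]. *)
Lemma D_in_comp_inverse (I : R -> Prop) (x x' y y' g : R -> R) (t0 : R) :
  inverse_continuous_on I x -> (forall t, I t -> g (x t) = t) -> I t0 ->
  D_in x x' I t0 -> D_in y y' I t0 -> x' t0 <> 0 ->
  D_in (fun u => y (g u)) (fun u => y' (g u) / x' (g u)) (image I x) (x t0).
Proof.
  intros Hinv Hg H0 Hx Hy Hn.
  pose proof (limit_comp_inverse _ _ _ _ _ _ Hinv Hg H0
    (limit_mul _ _ _ _ _ _ Hy (limit_inv _ _ _ _ Hx Hn))) as H.
  unfold D_in; rewrite (Hg t0 H0).
  refine (limit1_ext _ _ _ _ _ _ H).
  intros u [[t [Ht <-]] Hne]; rewrite (Hg t Ht); field.
  repeat split; try lra; intros E; apply Hne; f_equal; lra.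
Qed.

(** * From the soliton equation to the graph *)

Lemma soliton_x'_neq_0 (p v a : R * R) :
  hyperbolic_curvature p v a <> 0 ->
  1 / hyperbolic_curvature p v a
    = - hyp_inner p (unit_normal p v) partial_y ->
  fst v <> 0.
Proof.
  intros Hk E Hv.
  apply (Rinv_neq_0_compat _ Hk).
  unfold Rdiv in E; rewrite Rmult_1_l in E; rewrite E.
  unfold hyp_inner, unit_normal, partial_y, Rdiv; simpl; rewrite Hv; ring.
Qed.

Lemma regular_curve_graph (I : R -> Prop) (gamma gamma' gamma'' : R -> R * R) :
  interval I -> regular_curve I gamma gamma' gamma'' ->
  (forall t, I t -> fst (gamma' t) <> 0) -> graph_on_x_axis I gamma.
Proof.
  intros HI [Hx [Hy _]] Hn.
  set (x := fun t => fst (gamma t)) in *.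
  set (x' := fun t => fst (gamma' t)) in *.
  set (x'' := fun t => fst (gamma'' t)) in *.
  set (y := fun t => snd (gamma t)) in *.
  set (y' := fun t => snd (gamma' t)) in *.
  set (y'' := fun t => snd (gamma'' t)) in *.
  change (forall t, I t -> x' t <> 0) in Hn.
  assert (Hinv : (forall a b, I a -> I b -> x a = x b -> a = b) /\
    inverse_continuous_on I x).
  { destruct (monotone_of_derivative_neq_0 I x x' HI) as [H|H];
      try (intros t Ht; apply (Hx t Ht)).
    - intros t Ht; exact (cont_deriv _ _ _ _ (proj1 (proj2 (Hx t Ht)))).
    - exact Hn.
    - split; [exact (strictly_increasing_inj I x H)|].
      exact (strictly_increasing_inv_cont I x HI H).
    - split.
      + intros a b Ha Hb E; apply (strictly_increasing_inj I _ H a b Ha Hb).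
        rewrite E; reflexivity.
      + intros t0 eps H0 He.
        destruct (strictly_increasing_inv_cont I _ HI H t0 eps H0 He)
          as [d [Hd Hd']].
        exists d; split; [exact Hd|]; intros t Ht Hlt; apply (Hd' t Ht).
        rewrite <- Rabs_Ropp; replace (- (- x t - - x t0)) with (x t - x t0)
          by ring; exact Hlt. }
  destruct Hinv as [Hinj Hinv].
  (* The inverse of [x] on its image; elsewhere its value is arbitrary, and [0] only shows that R is
     inhabited. *)
  set (g := fun u => epsilon (inhabits 0) (fun t => I t /\ x t = u)).
  assert (Hg : forall t, I t -> g (x t) = t).
  { intros t Ht.
    destruct (epsilon_spec (inhabits 0) (fun s => I s /\ x s = x t)
      (ex_intro _ t (conj Ht eq_refl))) as [H1 H2].
    exact (Hinj _ _ H1 Ht H2). }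
  (* The slope dy/dx as a function of the parameter, followed by its derivative in [t]; the second
     derivative of the graph is then [m' / x']. *)
  set (m := fun t => y' t * / x' t).
  set (m' := fun t => y'' t * / x' t + y' t * (- x'' t / x' t ^ 2)).
  assert (Hm : forall t, I t -> D_in m m' I t).
  { intros t Ht.
    destruct (Hx t Ht) as [_ [Hx2 _]]; destruct (Hy t Ht) as [_ [Hy2 _]].
    exact (Dmult I y'' _ y' _ t Hy2 (D_in_inv I x' x'' t Hn Ht Hx2)). }
  exists (image I x), (fun u => y (g u)), (fun u => m (g u)),
    (fun u => m' (g u) / x' (g u)).
  split; [|split].
  - apply interval_image; [exact HI | | exact Hinj].
    intros t Ht; exact (cont_deriv _ _ _ _ (proj1 (Hx t Ht))).
  - intros u [t [Ht <-]].
    destruct (Hx t Ht) as [Hx1 [Hx2 Hx3]]; destruct (Hy t Ht) as [Hy1 [Hy2 Hy3]].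
    split; [|split].
    + exact (D_in_comp_inverse I x x' y y' g t Hinv Hg Ht Hx1 Hy1 (Hn t Ht)).
    + exact (D_in_comp_inverse I x x' m m' g t Hinv Hg Ht Hx1 (Hm t Ht)
        (Hn t Ht)).
    + unfold continue_in; rewrite (Hg t Ht).
      (* It remains to see that [m' / x'] is continuous in the parameter, which follows factor by
         factor from the continuity of the first and second derivatives. *)
      apply (limit_comp_inverse I x g (fun s => m' s / x' s) t _ Hinv Hg Ht).
      pose proof (cont_deriv _ _ _ _ Hx2 : limit1_in x' (D_x I t) (x' t) t)
        as Cx'.
      pose proof (cont_deriv _ _ _ _ Hy2 : limit1_in y' (D_x I t) (y' t) t)
        as Cy'.
      pose proof (limit_inv _ _ _ _ Cx' (Hn t Ht)) as Cinv.
      assert (Cinv2 : limit1_in (fun s => / x' s ^ 2) (D_x I t)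
        (/ x' t ^ 2) t).
      { apply (limit_inv (fun s => x' s ^ 2)).
        - simpl; repeat apply limit_mul; try exact Cx'.
          exact (limit_free (fun _ => 1) _ 0 t).
        - apply pow_nonzero, Hn, Ht. }
      apply limit_mul; [|exact Cinv].
      apply limit_plus; apply limit_mul; try assumption.
      apply limit_mul; [apply limit_Ropp|]; assumption.
  - intros [u v]; simpl; split.
    + intros [t [Ht E]].
      assert (Eu : x t = u) by (unfold x; rewrite E; reflexivity).
      split; [exists t; auto|].
      rewrite <- Eu, (Hg t Ht); unfold y; rewrite E; reflexivity.
    + intros [[t [Ht <-]] ->]; exists t; split; [exact Ht|].
      rewrite (Hg t Ht); apply surjective_pairing.
Qed.

Theorem proposition5p4 (I : R -> Prop) (gamma : R -> R * R)
    (HI : interval I) (Hsol : conformal_soliton I gamma) :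
  graph_on_x_axis I gamma.
Proof.
  destruct Hsol as [gamma' [gamma'' [Hreg Heq]]].
  apply (regular_curve_graph I gamma gamma' gamma'' HI Hreg).
  intros t Ht; destruct (Heq t Ht) as [Hk E].
  exact (soliton_x'_neq_0 _ _ _ Hk E).
Qed.
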